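(* The logics $\square\mathbf{T}:=\mathbf{K}+\square(\square p\to p)$, $\mathbf{K5}$ and $\mathbf{K45}$ are Horn axiomatizable, and none of them is semiproduct-matching with $\mathbf{S5}$; that is, $[\Lambda,\mathbf{S5}]^{\mathrm{EX}}\neq\Lambda\rightthreetimes\mathbf{S5}$ for each $\Lambda\in\{\square\mathbf{T},\mathbf{K5},\mathbf{K45}\}$.
   Context: All propositional modal logics are normal. $\Lambda$ is in the language with the modality $\square$ (dual $\Diamond$), and $\mathbf{S5}$ is in the language with the modality $\blacksquare$. $L+A$ denotes the smallest normal modal logic containing $L$ and the formula $A$; $\mathbf{K}$ is the minimal normal modal logic, $\mathbf{K5}=\mathbf{K}+(\Diamond p\to\square\Diamond p)$, $\mathbf{K45}=\mathbf{K5}+(\square p\to\square\square p)$. A logic is Horn axiomatizable if it can be axiomatized over $\mathbf{K}$ by variable-free formulas and formulas whose class of Kripke frames $(W,R)$ is defined by a first-order sentence of the form $\forall x\forall y\forall\bar z\,(\psi(x,y,\bar z)\to R(x,y))$ with $\psi$ a positive first-order formula in $R$ and equality. $[\Lambda,\mathbf{S5}]^{\mathrm{EX}}$ is the bimodal logic $\Lambda*\mathbf{S5}+(\square\blacksquare p\to\blacksquare\square p)$, where $*$ denotes fusion (the smallest normal bimodal logic containing both). The product of Kripke frames $F_1=(U_1,R_1)$ and $F_2=(U_2,R_2)$ is $F_1\times F_2:=(U_1\times U_2,R_h,R_v)$ with $R_h(u,v)=R_1(u)\times\{v\}$ and $R_v(u,v)=\{u\}\times R_2(v)$, where $R(x)=\{y\mid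 xRy\}$. A semiproduct of $F_1$ and $F_2$ is a restriction of $F_1\times F_2$ to a nonempty subset $W\subseteq U_1\times U_2$ such that $R_h(W)\subseteq W$. The modality $\square$ is interpreted by $R_h$ and $\blacksquare$ by $R_v$. The semiproduct $\Lambda\rightthreetimes\mathbf{S5}$ is the bimodal logic (set of valid formulas) of the class of all semiproducts of $\Lambda$-frames with $\mathbf{S5}$-frames (an $L$-frame is a Kripke frame validating $L$). *)

(* Defs.v *)
Set Implicit Arguments.

(** [form M] is the propositional modal language with one box for each element
    of [M]; [form unit] is the unimodal language. *)

Inductive form (M : Type) : Type :=
| var : nat -> form M
| bot : form M
| imp : form M -> form M -> form M
| box : M -> form M -> form M.

Arguments var {M} _.
Arguments bot {M}.

Definition neg {M} (A : form M) : form M := imp A bot.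
Definition dia {M} (m : M) (A : form M) : form M := neg (box m (neg A)).

Fixpoint subst {M} (s : nat -> form M) (A : form M) : form M :=
  match A with
  | var i => s i
  | bot => bot
  | imp B C => imp (subst s B) (subst s C)
  | box m B => box m (subst s B)
  end.

Fixpoint relabel {M N} (f : M -> N) (A : form M) : form N :=
  match A with
  | var i => var i
  | bot => bot
  | imp B C => imp (relabel f B) (relabel f C)
  | box m B => box (f m) (relabel f B)
  end.

Fixpoint variable_free {M} (A : form M) : Prop :=
  match A with
  | var _ => False
  | bot => True
  | imp B C => variable_free B /\ variable_free C
  | box _ B => variable_free B
  end.

Definition logic (M : Type) := form M -> Prop.

Definition sublogic {M} (L1 L2 : logic M) : Prop := forall A, L1 A -> L2 A.
Definition same_logic {M} (L1 L2 : logic M) : Prop := forall A, L1 A <-> L2 A.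

(** Boolean evaluation in which variables and boxed formulas are both treated
    as atoms, so that [tautology] covers the modal instances of the classical
    tautologies. *)
Fixpoint bool_eval {M} (v : form M -> bool) (A : form M) : bool :=
  match A with
  | bot => false
  | imp B C => implb (bool_eval v B) (bool_eval v C)
  | _ => v A
  end.

Definition tautology {M} (A : form M) : Prop :=
  forall v, bool_eval v A = true.

Definition axK {M} (m : M) : form M :=
  imp (box m (imp (var 0) (var 1))) (imp (box m (var 0)) (box m (var 1))).

Record normal {M} (L : logic M) : Prop := {
  normal_taut : forall A, tautology A -> L A;
  normal_K : forall m, L (axK m);
  normal_MP : forall A B, L (imp A B) -> L A -> L B;
  normal_subst : forall s A, L A -> L (subst s A);
  normal_nec : forall m A, L A -> L (box m A)
}.

(** The smallest normal logic containing [G]. *)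
Definition smallest_normal {M} (G : logic M) : logic M :=
  fun A => forall L, normal L -> sublogic G L -> L A.

Definition extend {M} (L G : logic M) : logic M :=
  smallest_normal (fun A => L A \/ G A).

(** [L + A]. *)
Definition plus {M} (L : logic M) (A : form M) : logic M :=
  extend L (fun B => B = A).

Definition K {M} : logic M := smallest_normal (fun _ => False).

Notation uform := (form unit).
Notation ubox := (box tt).
Notation udia := (dia tt).

Definition axT : uform := imp (ubox (var 0)) (var 0).
Definition ax4 : uform := imp (ubox (var 0)) (ubox (ubox (var 0))).
Definition axB : uform := imp (var 0) (ubox (udia (var 0))).
Definition ax5 : uform := imp (udia (var 0)) (ubox (udia (var 0))).

Definition BoxT : logic unit := plus K (ubox axT).
Definition K5 : logic unit := plus K ax5.
Definition K45 : logic unit := plus K5 ax4.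
Definition S5 : logic unit := plus (plus (plus K axT) ax4) axB.

Record frame (M : Type) := Frame {
  world :> Type;
  rel : M -> world -> world -> Prop;
  world_nonempty : inhabited world
}.

Fixpoint sat {M} (F : frame M) (V : nat -> F -> Prop) (x : F) (A : form M)
    : Prop :=
  match A with
  | var i => V i x
  | bot => False
  | imp B C => sat F V x B -> sat F V x C
  | box m B => forall y, rel F m x y -> sat F V y B
  end.

Definition valid {M} (F : frame M) (A : form M) : Prop :=
  forall V x, sat F V x A.

Definition logic_frame {M} (L : logic M) (F : frame M) : Prop :=
  forall A, L A -> valid F A.

(** Positive first-order formulas over one binary relation and equality, with
    variables named by natural numbers. *)
Inductive posfo : Type :=
| PEq : nat -> nat -> posfo
| PRel : nat -> nat -> posfo
| PAnd : posfo -> posfo -> posfo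
| POr : posfo -> posfo -> posfo
| PEx : nat -> posfo -> posfo
| PAll : nat -> posfo -> posfo.

Definition update {W : Type} (s : nat -> W) (i : nat) (w : W) : nat -> W :=
  fun j => if Nat.eqb j i then w else s j.

Fixpoint holds (F : frame unit) (s : nat -> F) (psi : posfo) : Prop :=
  match psi with
  | PEq i j => s i = s j
  | PRel i j => rel F tt (s i) (s j)
  | PAnd a b => holds F s a /\ holds F s b
  | POr a b => holds F s a \/ holds F s b
  | PEx i a => exists w, holds F (update s i w) a
  | PAll i a => forall w, holds F (update s i w) a
  end.

(** Truth of the sentence [forall x y zs, psi(x,y,zs) -> R(x,y)]: the variables
    [x] and [y] are those numbered 0 and 1, [zs] are the other free variables
    of [psi], and the universal closure is taken by ranging over assignments. *)
Definition horn_sentence (psi : posfo) (F : frame unit) : Prop :=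
  forall s : nat -> F, holds F s psi -> rel F tt (s 0) (s 1).

Definition horn_formula (A : uform) : Prop :=
  exists psi, forall F : frame unit, valid F A <-> horn_sentence psi F.

Definition horn_axiomatizable (L : logic unit) : Prop :=
  exists G : logic unit,
    (forall A, G A -> variable_free A \/ horn_formula A) /\
    same_logic L (extend K G).

(** [hor] indexes the white box, interpreted by the horizontal relation [R_h];
    [ver] indexes the black box, interpreted by the vertical relation [R_v]. *)
Inductive modality : Type := hor | ver.

Definition fusion (L1 L2 : logic unit) : logic modality :=
  smallest_normal (fun A =>
    (exists B, L1 B /\ A = relabel (fun _ => hor) B) \/
    (exists B, L2 B /\ A = relabel (fun _ => ver) B)).

Definition axEX : form modality :=
  imp (box hor (box ver (var 0))) (box ver (box hor (var 0))).

(** The logic written [[L1, L2]^EX]. *)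
Definition commEX (L1 L2 : logic unit) : logic modality :=
  plus (fusion L1 L2) axEX.

Definition product (F1 F2 : frame unit) : frame modality :=
  @Frame modality (F1 * F2)
    (fun m p q =>
       match m with
       | hor => rel F1 tt (fst p) (fst q) /\ snd q = snd p
       | ver => fst q = fst p /\ rel F2 tt (snd p) (snd q)
       end)
    (match world_nonempty F1, world_nonempty F2 with
     | inhabits u, inhabits v => inhabits (u, v)
     end).

Definition restrict {M} (F : frame M) (W : F -> Prop) (ne : exists x, W x)
    : frame M :=
  @Frame M {x : F | W x}
    (fun m x y => rel F m (proj1_sig x) (proj1_sig y))
    (match ne with ex_intro _ x Wx => inhabits (exist W x Wx) end).

Definition hor_closed (F1 F2 : frame unit) (W : product F1 F2 -> Prop) : Prop :=
  forall p q, W p -> rel (product F1 F2) hor p q -> W q.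

Definition semiproduct_logic (L1 L2 : logic unit) : logic modality :=
  fun A =>
    forall F1 F2 : frame unit, logic_frame L1 F1 -> logic_frame L2 F2 ->
    forall (W : product F1 F2 -> Prop) (ne : exists p, W p),
    hor_closed W -> valid (restrict (product F1 F2) W ne) A.

Definition semiproduct_matching (L1 L2 : logic unit) : Prop :=
  same_logic (commEX L1 L2) (semiproduct_logic L1 L2).

(* Main.v *)
Require Import Defs.
From Stdlib Require Import Bool Classical ClassicalEpsilon.

Set Implicit Arguments.

(** In a frame of any of the three logics every successor is reflexive.  In a
    semiproduct, horizontal reflexivity of a point depends on its first
    coordinate only, so it is inherited by all vertical neighbours, and
    [box hor (box ver (box hor p -> p))] is valid.  It fails on the two-point
    frame in which every point sees horizontally just one of them, and vertically
    both; yet this frame validates all three logics, [S5] and [axEX]. *)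

(** * Kripke soundness of logics given by axioms *)

Definition truth (P : Prop) : bool :=
  if excluded_middle_informative P then true else false.

Lemma truthP (P : Prop) : truth P = true <-> P.
Proof.
  unfold truth; destruct (excluded_middle_informative P); intuition discriminate.
Qed.

(** Satisfaction at a fixed point acts as a boolean valuation of variables and boxed formulas, so
    every tautology, modal instances included, is true there. *)
Lemma bool_eval_sat M (F : frame M) V x A :
  bool_eval (fun B => truth (sat F V x B)) A = true <-> sat F V x A.
Proof.
  induction A as [i| |B IHB C IHC|m B _]; simpl.
  - apply truthP.
  - intuition discriminate.
  - rewrite implb_true_iff, IHB, IHC; tauto.
  - apply truthP.
Qed.

Lemma sat_subst M (F : frame M) s V A x :
  sat F V x (subst s A) <-> sat F (fun i y => sat F V y (s i)) x A.
Proof.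
  revert x; induction A as [i| |B IHB C IHC|m B IHB]; intro x; simpl.
  - tauto.
  - tauto.
  - rewrite IHB, IHC; tauto.
  - split; intros H y xy; apply IHB, H, xy.
Qed.

Lemma valid_normal M (F : frame M) : normal (valid F).
Proof.
  split.
  - intros A tA V x; apply bool_eval_sat, tA.
  - intros m V x; simpl; auto.
  - intros A B AB HA V x; exact (AB V x (HA V x)).
  - intros s A HA V x; apply sat_subst, HA.
  - intros m A HA V x y _; apply HA.
Qed.

(** The formulas valid in [F] form a normal logic, so minimality leaves only the axioms to be
    checked. *)
Lemma smallest_normal_frame M (G : logic M) (F : frame M) :
  logic_frame (smallest_normal G) F <-> logic_frame G F.
Proof.
  split; intros H A HA.
  - apply H; intros L _ GL; exact (GL A HA).
  - exact (HA _ (valid_normal F) H).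
Qed.

Lemma K_frame M (F : frame M) : logic_frame K F.
Proof. apply smallest_normal_frame; intros A []. Qed.

Lemma plus_frame M (L : logic M) A (F : frame M) :
  logic_frame (plus L A) F <-> logic_frame L F /\ valid F A.
Proof.
  unfold plus, extend; rewrite smallest_normal_frame; split.
  - intro H; split; [intros B LB|]; apply H; auto.
  - intros [LF AF] B [LB| ->]; auto.
Qed.

Lemma smallest_normal_incl M (G : logic M) : sublogic G (smallest_normal G).
Proof. intros A GA L _ GL; exact (GL A GA). Qed.

Lemma smallest_normal_normal M (G : logic M) : normal (smallest_normal G).
Proof.
  split.
  - intros A tA L nL _; exact (normal_taut nL tA).
  - intros m L nL _; exact (normal_K nL m).
  - intros A B AB HA L nL GL;
      exact (normal_MP nL A B (AB L nL GL) (HA L nL GL)).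
  - intros s A HA L nL GL; exact (normal_subst nL s A (HA L nL GL)).
  - intros m A HA L nL GL; exact (normal_nec nL m A (HA L nL GL)).
Qed.

(** Brings a two-step extension such as [K45] to the shape required by [horn_axiomatizable]: one set
    of axioms over [K]. *)
Lemma plus_plus M (L : logic M) A B :
  same_logic (plus (plus L A) B) (extend L (fun C => C = A \/ C = B)).
Proof.
  intro C; split; intro H; apply H; try apply smallest_normal_normal.
  - intros D [LD| ->].
    + apply LD; [apply smallest_normal_normal|].
      intros E [LE| ->]; apply smallest_normal_incl; auto.
    + apply smallest_normal_incl; auto.
  - intros D [LD|[-> | ->]]; apply smallest_normal_incl; auto;
      left; apply smallest_normal_incl; auto.
Qed.

Definition reduct M N (f : M -> N) (F : frame N) : frame M :=
  @Frame M F (fun m => rel F (f m)) (world_nonempty F).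

Lemma sat_relabel M N (f : M -> N) (F : frame N) V A (x : F) :
  sat F V x (relabel f A) <-> sat (reduct f F) V x A.
Proof.
  revert x; induction A as [i| |B IHB C IHC|m B IHB]; intro x; simpl.
  - tauto.
  - tauto.
  - rewrite IHB, IHC; tauto.
  - split; intros H y xy; apply IHB, H, xy.
Qed.

Lemma commEX_frame L1 L2 (F : frame modality) :
  logic_frame L1 (reduct (fun _ => hor) F) ->
  logic_frame L2 (reduct (fun _ => ver) F) ->
  valid F axEX -> logic_frame (commEX L1 L2) F.
Proof.
  intros F1 F2 FEX; apply plus_frame; split; [|exact FEX].
  apply smallest_normal_frame; intros A [[B [LB ->]]|[B [LB ->]]] V x;
    apply sat_relabel; auto.
  - exact (F1 B LB V x).
  - exact (F2 B LB V x).
Qed.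

(** * First-order frame conditions for the unimodal axioms *)

Section Correspondence.

Variable F : frame unit.
Notation "x --> y" := (rel F tt x y) (at level 70).

Lemma valid_boxT : valid F (ubox axT) <-> forall x y, x --> y -> y --> y.
Proof.
  split.
  (* The least valuation making the boxed variable true at [y]. *)
  - intros H x y xy; exact (H (fun _ w => y --> w) x y xy (fun _ r => r)).
  - intros H V x y xy Hy; exact (Hy y (H x y xy)).
Qed.

Lemma valid_T : (forall x, x --> x) -> valid F axT.
Proof. intros H V x Hx; exact (Hx x (H x)). Qed.

Lemma valid_4 :
  valid F ax4 <-> forall x y z, x --> y -> y --> z -> x --> z.
Proof.
  split.
  - intros H x y z xy yz.
    exact (H (fun _ w => x --> w) x (fun _ r => r) y xy z yz).
  - intros H V x Hx y xy z yz; exact (Hx z (H x y z xy yz)).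
Qed.

Lemma valid_B : (forall x y, x --> y -> y --> x) -> valid F axB.
Proof. intros H V x Vx y xy Hy; exact (Hy x (H x y xy) Vx). Qed.

Lemma valid_5 :
  valid F ax5 <-> forall x y z, x --> y -> x --> z -> y --> z.
Proof.
  split.
  - intros H x y z xy xz; apply NNPP; intro nyz.
    (* With the variable true at [z] alone, its diamond holds at [x], hence at [y], and only an
       arrow from [y] to [z] can witness it there. *)
    refine (H (fun _ w => w = z) x _ y xy _).
    + intro Hx; exact (Hx z xz eq_refl).
    + intros w yw Ew; simpl in Ew; subst w; exact (nyz yw).
  - intros H V x Hx y xy Hy; apply Hx; intros z xz.
    exact (Hy z (H x y z xy xz)).
Qed.

End Correspondence.

(** * Horn axiomatizability *)

Lemma horn_formula_boxT : horn_formula (ubox axT).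
Proof.
  (* A Horn sentence concludes [R(x,y)] for two variables; the equation [x = y] in the premise turns
     this into reflexivity of a point with a predecessor. *)
  exists (PAnd (PEq 0 1) (PEx 2 (PRel 2 0))); intro F.
  rewrite valid_boxT; split.
  - intros H s [E [w wx]]; cbn in *; rewrite <- E; exact (H w _ wx).
  - intros H x y xy; apply (H (fun _ => y)); cbn; eauto.
Qed.

Lemma horn_formula_5 : horn_formula ax5.
Proof.
  exists (PEx 2 (PAnd (PRel 2 0) (PRel 2 1))); intro F.
  rewrite valid_5; split.
  - intros H s [w [wx wy]]; exact (H w _ _ wx wy).
  - intros H x y z xy xz.
    apply (H (fun n => match n with 0 => y | _ => z end)); exists x; cbn; auto.
Qed.

Lemma horn_formula_4 : horn_formula ax4.
Proof.
  exists (PEx 2 (PAnd (PRel 0 2) (PRel 2 1))); intro F.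
  rewrite valid_4; split.
  - intros H s [w [xw wy]]; exact (H _ w _ xw wy).
  - intros H x y z xy yz.
    apply (H (fun n => match n with 0 => x | _ => z end)); exists y; cbn; auto.
Qed.

Lemma horn_axiomatizable_plus A :
  horn_formula A -> horn_axiomatizable (plus K A).
Proof.
  intro hA; exists (fun B => B = A); split.
  - intros B ->; auto.
  - intro B; reflexivity.
Qed.

Lemma horn_axiomatizable_K45 : horn_axiomatizable K45.
Proof.
  exists (fun B => B = ax5 \/ B = ax4); split.
  - intros B [-> | ->]; right; [apply horn_formula_5|apply horn_formula_4].
  - apply plus_plus.
Qed.

(** * The separating frame and formula *)

Definition two_point : frame modality :=
  @Frame modality bool
    (fun m _ y => match m with hor => y = true | ver => True end)
    (inhabits true).

Notation two_point_hor := (reduct (fun _ : unit => hor) two_point).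

Definition reflexivity_spreads : form modality :=
  box hor (box ver (imp (box hor (var 0)) (var 0))).

Lemma two_point_EX : valid two_point axEX.
Proof.
  (* Every point is reached from [x] by a horizontal step to [true] and a vertical one, so the
     premise makes the variable true everywhere. *)
  intros V x Hx y _ z Ez; exact (Hx true eq_refl z I).
Qed.

Lemma two_point_S5 : logic_frame S5 (reduct (fun _ => ver) two_point).
Proof.
  repeat (apply plus_frame; split).
  - apply K_frame.
  - apply valid_T; exact (fun _ => I).
  - apply valid_4; exact (fun _ _ _ _ _ => I).
  - apply valid_B; exact (fun _ _ _ => I).
Qed.

Lemma two_point_refutes : ~ valid two_point reflexivity_spreads.
Proof.
  intro H.
  (* The path stays at [true] horizontally, then drops to [false], where the variable fails although
     it holds at the only horizontal successor. *)
  discriminate (H (fun _ w => w = true) true true eq_refl false I (fun _ r => r)).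
Qed.

Lemma semiproduct_reflexivity_spreads L1 L2 :
  (forall F, logic_frame L1 F -> valid F (ubox axT)) ->
  semiproduct_logic L1 L2 reflexivity_spreads.
Proof.
  intros HT F1 F2 L1F _ W ne _ V [[u v] Wx] [[u' v'] Wy] [uu' _]
    [[u'' v''] Wz] [E _] Hz; cbn in *; subst u''.
  (* The horizontal loop at [(u', v'')] is needed; it comes from reflexivity of [u'], a successor of
     [u]. *)
  apply Hz; split; [|reflexivity].
  exact (proj1 (valid_boxT F1) (HT F1 L1F) u u' uu').
Qed.

(** [two_point] is a frame of [commEX L S5], so a match would make it validate
    [reflexivity_spreads]. *)
Lemma not_semiproduct_matching L :
  (forall F, logic_frame L F -> valid F (ubox axT)) ->
  logic_frame L two_point_hor -> ~ semiproduct_matching L S5.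
Proof.
  intros HT HF HM; apply two_point_refutes.
  apply (commEX_frame HF two_point_S5 two_point_EX).
  apply HM, semiproduct_reflexivity_spreads, HT.
Qed.

Lemma K5_frame_boxT F : logic_frame K5 F -> valid F (ubox axT).
Proof.
  intro HF; apply plus_frame in HF; destruct HF as [_ H5].
  rewrite valid_5 in H5; apply valid_boxT.
  (* Euclideanness applied to the same arrow twice. *)
  intros x y xy; exact (H5 x y y xy xy).
Qed.

Lemma two_point_K5 : logic_frame K5 two_point_hor.
Proof.
  apply plus_frame; split; [apply K_frame|].
  (* Horizontal arrows of [two_point] depend on their target alone, so an arrow from [x] to [z] is
     also one from [y] to [z]. *)
  apply valid_5; intros x y z _ E; exact E.
Qed.

Theorem mainTheorem2 :
  (horn_axiomatizable BoxT /\ ~ semiproduct_matching BoxT S5) /\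
  (horn_axiomatizable K5 /\ ~ semiproduct_matching K5 S5) /\
  (horn_axiomatizable K45 /\ ~ semiproduct_matching K45 S5).
Proof.
  repeat split.
  - exact (horn_axiomatizable_plus horn_formula_boxT).
  - apply not_semiproduct_matching.
    + intros F HF; apply plus_frame in HF; tauto.
    + apply plus_frame; split; [apply K_frame|].
      apply valid_boxT; intros x y E; exact E.
  - exact (horn_axiomatizable_plus horn_formula_5).
  - exact (not_semiproduct_matching K5_frame_boxT two_point_K5).
  - exact horn_axiomatizable_K45.
  - apply not_semiproduct_matching.
    + intros F HF; apply plus_frame in HF; apply K5_frame_boxT; tauto.
    + apply plus_frame; split; [exact two_point_K5|].
      apply valid_4; intros x y z _ E; exact E.
Qed.
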